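(* Let $G$ be a finite abelian group with $d(G)=2$. Then the graph $\Delta(G)$ is regular if and only if all Sylow subgroups of $G$ are non-cyclic.
   Context: $d(G)$ is the minimum size of a generating set of $G$. The generating graph $\Gamma(G)$ of a group $G$ is the simple graph with vertex set $G$ in which two distinct vertices $x,y$ are adjacent if and only if $\langle x,y\rangle=G$. $\Delta(G)$ is the subgraph of $\Gamma(G)$ induced by its non-isolated vertices. Sylow subgroups are the Sylow $p$-subgroups for primes $p$ dividing $|G|$. *)

(* Defs.v *)
From mathcomp Require Import all_boot all_fingroup all_solvable.

Set Implicit Arguments.
Unset Strict Implicit.
Unset Printing Implicit Defensive.

Local Open Scope group_scope.

Section Graph.
Variable T : finType.

(* A graph is a vertex set V together with an adjacency relation e on the
   ambient type, only ever read on V; the subgraph induced by W \subset V is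
   therefore the pair (W, e). *)
Definition neighbours (V : {set T}) (e : rel T) (x : T) : {set T} :=
  [set y in V | e x y].

Definition non_isolated (V : {set T}) (e : rel T) : {set T} :=
  [set x in V | neighbours V e x != set0].

Definition regular_graph (V : {set T}) (e : rel T) : Prop :=
  exists k : nat, forall x, x \in V -> #|neighbours V e x| = k.

End Graph.

Section GeneratingGraph.
Variable gT : finGroupType.

Definition gen_adj (G : {set gT}) : rel gT :=
  [rel x y | (x != y) && (<<[set x; y]>> == G)].

Definition Delta_vertices (G : {set gT}) : {set gT} :=
  non_isolated G (gen_adj G).

Definition Delta_regular (G : {set gT}) : Prop :=
  regular_graph (Delta_vertices G) (gen_adj G).

End GeneratingGraph.

(* Main.v *)
Require Import Defs.
From mathcomp Require Import all_boot all_fingroup all_solvable.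

Set Implicit Arguments.
Unset Strict Implicit.
Unset Printing Implicit Defensive.

Local Open Scope group_scope.

(* The neighbours of a vertex [x] are the lifts of the generators of the cyclic
   group [G / <[x]>], so [x] has degree [#[x] * totient #|G : <[x]>|]. If no
   Sylow subgroup is cyclic, then [<[x]>] contains none of them, so
   [#|G : <[x]>|] has the same prime divisors as [#|G|], and the degree is
   [totient #|G|] for every [x]. If on the contrary some Sylow [p]-subgroup
   [<[g]>] is cyclic, choose [x] a [p^']-element adjacent to some [z]: each
   neighbour of [x] is one of [g * x], but the [p^']-part of [z] is a neighbour
   of [g * x] only. *)

(** Euler's product formula for the totient, cleared of denominators to stay in [nat]: each factor
    [p.-1 * p ^ e.-1] of the totient absorbs one [p] to become [p.-1 * p ^ e]. *)
Lemma totient_prod_primes n : 0 < n ->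
  (totient n * \prod_(p <- primes n) p = n * \prod_(p <- primes n) p.-1)%N.
Proof.
move=> n_gt0; rewrite totientE // -big_split /=.
rewrite [X in _ = (X * _)%N](prod_prime_decomp n_gt0) prime_decompE big_map.
rewrite -big_split /=.
rewrite big_seq [RHS]big_seq; apply: eq_bigr => p p_n.
by rewrite -mulnA -expnSr prednK ?logn_gt0 // mulnC.
Qed.

(** The ratio of [totient n] to [n] depends only on the prime divisors of [n]; the statement is
    cross-multiplied. *)
Lemma eq_primes_totient m n : 0 < m -> 0 < n -> primes m = primes n ->
  (totient m * n = totient n * m)%N.
Proof.
move=> m_gt0 n_gt0 eq_mn; set q := (\prod_(p <- primes n) p)%N.
have q_gt0 : 0 < q.
  rewrite /q big_seq; apply: prodn_cond_gt0 => p.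
  by rewrite mem_primes => /and3P[/prime_gt0].
have := totient_prod_primes m_gt0; have := totient_prod_primes n_gt0.
rewrite eq_mn -/q => En Em; apply/eqP; rewrite -(eqn_pmul2r q_gt0).
by rewrite mulnAC Em [eqbRHS]mulnAC En mulnAC (mulnC m) mulnAC.
Qed.

Section GroupLemmas.
Variable gT : finGroupType.
Implicit Types (G H P : {group gT}) (x y z : gT).

Lemma card_cosetpre_set H (A : {set coset_of H}) :
  #|coset H @*^-1 A| = (#|A| * #|H|)%N.
Proof.
rewrite -sum1_card (partition_big (coset H) (mem A)) /=; last first.
  by move=> y /morphpreP[].
rewrite -sum_nat_const; apply: eq_bigr => u Au.
have <- : #|coset H @*^-1 [set u]| = #|H|.
  by case: (cosetP u) => x Nx ->; rewrite cosetpre_set1 ?card_rcoset.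
rewrite sum1dep_card; apply: eq_card => y; rewrite !inE.
by rewrite -andbA; congr (_ && _); apply: andb_idl => /eqP yu;
  rewrite -[_ y]/(coset H y) yu.
Qed.

Lemma set2_gen x y : <<[set x; y]>> = <[x]> <*> <[y]>.
Proof. by rewrite joing_idl joing_idr. Qed.

(** A subgroup containing [<[x]>] is determined by its image modulo [<[x]>], and here that image is
    generated by the coset of [y]. *)
Lemma cycle_join_eq_quotient G x y : abelian G -> x \in G -> y \in G ->
  (<[x]> <*> <[y]> == G) = generator (G / <[x]>) (coset <[x]> y).
Proof.
move=> abG Gx Gy; have sxG : <[x]> \subset G by rewrite cycle_subG.
have nxG : G \subset 'N(<[x]>) by apply: sub_abelian_norm.
have nxy : y \in 'N(<[x]>) by apply: (subsetP nxG).
have nxY : <[y]> \subset 'N(<[x]>) by rewrite cycle_subG.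
rewrite /generator -quotient_cycle //; apply/eqP/eqP => [<- | eqGy].
  by rewrite quotientYidl.
by rewrite -quotientYK // -eqGy quotientGK // /normal sxG.
Qed.

(** The mate [z] serves to make [G / <[x]>] cyclic; each generator of that quotient then lifts to a
    full coset of [#[x]] mates. *)
Lemma card_generating_mates G x z : abelian G -> <<[set x; z]>> = G ->
  #|[set y in G | <<[set x; y]>> == G]| = (totient #|G : <[x]>| * #[x])%N.
Proof.
move=> abG genG; have [Gx Gz] : x \in G /\ z \in G.
  by rewrite -genG !mem_gen ?inE ?eqxx ?orbT.
have sxG : <[x]> \subset G by rewrite cycle_subG.
have nxG : G \subset 'N(<[x]>) by apply: sub_abelian_norm.
have Gq : G / <[x]> = <[coset <[x]> z]>.
  by apply/eqP; rewrite -[_ == _]cycle_join_eq_quotient // -set2_gen genG.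
rewrite -card_quotient // Gq -/#[_] totient_gen -card_cosetpre_set.
apply: eq_card => y; rewrite inE set2_gen.
have [Gy | nGy] /= := boolP (y \in G).
  rewrite morphpreE in_setI (subsetP nxG) // 2!inE -Gq.
  by rewrite cycle_join_eq_quotient.
(* The preimage under [coset] is taken in the whole normaliser of [<[x]>], so a lift must still be
   shown to lie in [G]. *)
apply/esym/negP => /morphpreP[nxy]; rewrite inE -Gq => /eqP gen_y.
case/negP: nGy; rewrite -[G : {set _}](@quotientGK _ <[x]>) /normal ?sxG //.
by apply/morphpreP; rewrite gen_y cycle_id.
Qed.

Lemma noncyclic_neq_gen2 G x y : ~~ cyclic G -> <<[set x; y]>> = G -> x != y.
Proof.
move=> ncG genG; apply: contraNneq ncG => xy.
by rewrite -genG xy setUid cycle_cyclic.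
Qed.

Lemma neighbours_gen_adj G x : ~~ cyclic G ->
  neighbours G (gen_adj G) x = [set y in G | <<[set x; y]>> == G].
Proof.
move=> ncG; apply/setP=> y; rewrite !inE /=; congr (_ && _).
by apply: andb_idl => /eqP /(noncyclic_neq_gen2 ncG).
Qed.

(** Adjacency is symmetric, so a neighbour of [x] is itself non-isolated and no neighbour is lost in
    the induced subgraph. *)
Lemma neighbours_Delta G x : ~~ cyclic G -> x \in G ->
  neighbours (Delta_vertices G) (gen_adj G) x =
  [set y in G | <<[set x; y]>> == G].
Proof.
move=> ncG Gx; rewrite -neighbours_gen_adj //; apply/setP=> y; rewrite !inE /=.
apply: andb_id2r => /andP[neq_xy gen_xy]; apply: andb_idr => Gy.
by apply/set0Pn; exists x; rewrite inE Gx /gen_adj /= eq_sym neq_xy setUC.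
Qed.

Lemma Delta_verticesP G x : ~~ cyclic G ->
  reflect (exists y, <<[set x; y]>> = G) (x \in Delta_vertices G).
Proof.
move=> ncG; rewrite inE neighbours_gen_adj //.
apply: (iffP andP) => [[_ /set0Pn[y]] | [y genG]].
  by rewrite inE => /andP[_ /eqP]; exists y.
have [Gx Gy] : x \in G /\ y \in G.
  by rewrite -genG !mem_gen ?inE ?eqxx ?orbT.
by split=> //; apply/set0Pn; exists y; rewrite inE Gy genG /=.
Qed.

Lemma grank2_gen G : 'm(G) = 2 -> exists x, exists y, <<[set x; y]>> = G.
Proof.
move=> mG; have [B genB] := grank_witness G.
by rewrite mG => /eqP/cards2P[x [y [_ defB]]]; exists x, y; rewrite -defB.
Qed.

Lemma grank2_noncyclic G : 'm(G) = 2 -> ~~ cyclic G.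
Proof.
move=> mG; apply/negP => /cyclicP[x defG].
by have := grank_min [set x]; rewrite -/(<[x]>) -defG mG cards1.
Qed.

(** If [p] divided [#|G|] but not the index, a Sylow [p]-subgroup of [<[x]>] would be a cyclic Sylow
    subgroup of [G]. *)
Lemma primes_indexg_cycle G x : x \in G ->
    (forall p P, prime p -> p %| #|G| -> p.-Sylow(G) P -> ~~ cyclic P) ->
  primes #|G : <[x]>| = primes #|G|.
Proof.
move=> Gx ncS; have sxG : <[x]> \subset G by rewrite cycle_subG.
apply/eq_primes => p; rewrite !mem_primes indexg_gt0 cardG_gt0 /=.
have [p_pr | //] := boolP (prime p); rewrite /=.
apply/idP/idP => [|pG]; first by move/dvdn_trans; apply; apply: dvdn_indexg.
have [P sylP] := Sylow_exists p <[x]>.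
have sPx : P \subset <[x]> := pHall_sub sylP.
apply: contraLR (cyclicS sPx (cycle_cyclic x)) => p'i.
apply: (ncS p) => //.
rewrite pHallE (subset_trans sPx sxG) (card_Hall sylP) -(Lagrange sxG).
by rewrite partnM // [X in _ == (_ * X)%N]part_p'nat ?p'natE // muln1 /=.
Qed.

End GroupLemmas.

Theorem theorem5p11 (gT : finGroupType) (G : {group gT})
    (abG : abelian G) (dG : 'm(G) = 2) :
  Delta_regular G <->
  (forall (p : nat) (P : {group gT}),
     prime p -> p %| #|G| -> p.-Sylow(G) P -> ~~ cyclic P).
Proof.
have ncG := grank2_noncyclic dG; split=> [[k degG] p P p_pr pG sylP | ncS].
  apply/negP => /cyclicP[g defP].
  have [a [b gen_ab]] := grank2_gen dG.
  have [Ga Gb] : a \in G /\ b \in G.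
    by rewrite -gen_ab !mem_gen ?inE ?eqxx ?orbT.
  have sPG := pHall_sub sylP.
  have Pg : g \in P by rewrite defP cycle_id.
  have Gg : g \in G by apply: (subsetP sPG).
  have memP u : u \in G -> (u \in P) = p.-elt u.
    by apply: mem_normal_Hall; rewrite // -sub_abelian_normal.
  have p_g : p.-elt g by rewrite -memP.
  have cGG u v : u \in G -> v \in G -> commute u v.
    by move=> Gu Gv; apply: (centsP abG).
  (* Together [x] and [z] carry the [p^']-parts of both generators [a] and [b], while [g] accounts
     for all [p]-parts. *)
  set x := a.`_p^'; set z := g * b.`_p^'.
  have Gx : x \in G by rewrite groupX.
  have p'x : p^'.-elt x by apply: p_elt_constt.
  have constt_g u : u \in G -> p^'.-elt u ->
      (g * u).`_p = g /\ (g * u).`_p^' = u.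
    move=> Gu p'u; rewrite !consttM; try exact: cGG.
    rewrite (constt_p_elt p_g) (constt_p_elt p'u).
    have /constt1P -> := p'u; have /constt1P -> : p^'^'.-elt g by rewrite p_eltNK.
    by rewrite mulg1 mul1g.
  (* A subgroup of [G] containing [g] contains [P], hence contains any element
     of [G] whose [p^']-part it contains. *)
  have lift (H : {group gT}) u : g \in H -> u \in G -> u.`_p^' \in H -> u \in H.
    move=> Hg Gu Hu; rewrite -(consttC p u) groupM //.
    have : u.`_p \in P by rewrite memP ?groupX ?p_elt_constt.
    by rewrite defP; apply: subsetP; rewrite cycle_subG.
  have genG u v (H := <<[set u; v]>>) : u \in G -> v \in G ->
      a \in H -> b \in H -> H = G.
    move=> Gu Gv Ha Hb; apply/eqP; rewrite eqEsubset gen_subG subUset !sub1set.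
    by rewrite Gu Gv -gen_ab gen_subG subUset !sub1set Ha Hb.
  have mem2 (u v : gT) : u \in <<[set u; v]>> /\ v \in <<[set u; v]>>.
    by rewrite !mem_gen ?inE ?eqxx ?orbT.
  have Gz : z \in G by rewrite groupM ?groupX.
  have gen_xz : <<[set x; z]>> = G.
    have Gb' : b.`_p^' \in G by rewrite groupX.
    have [z_p z_p'] := constt_g _ Gb' (p_elt_constt p^' b).
    have [Hx Hz] := mem2 x z.
    have Hg : g \in <<[set x; z]>> by rewrite -z_p groupX.
    apply: genG => //; apply: lift => //.
    by rewrite -[b.`_p^']z_p' groupX.
  have Ggx : g * x \in G by rewrite groupM.
  have [gx_p gx_p'] := constt_g x Gx p'x.
  (* As the [p^']-part of [g * x], [x] is one of its powers. *)
  have neighbour_gx y : y \in G -> <<[set x; y]>> = G -> <<[set g * x; y]>> = G.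
    move=> Gy gen_xy; apply/eqP; rewrite eqEsubset gen_subG subUset !sub1set.
    have [Hgx Hy] := mem2 (g * x) y.
    by rewrite Ggx Gy -{1}gen_xy gen_subG subUset !sub1set -{1}gx_p' groupX.
  have gen_gxz' : <<[set g * x; z.`_p^']>> = G.
    have [Hgx Hz] := mem2 (g * x) z.`_p^'.
    have Hg : g \in <<[set g * x; z.`_p^']>> by rewrite -{1}gx_p groupX.
    have Hx : x \in <<[set g * x; z.`_p^']>> by rewrite -{1}gx_p' groupX.
    apply/eqP; rewrite eqEsubset gen_subG subUset !sub1set Ggx groupX //=.
    by rewrite -{1}gen_xz gen_subG subUset !sub1set Hx lift.
  (* Two commuting [p^']-elements generate a [p^']-group, whereas [p] divides [#|G|]. *)
  have ngen_xz' : <<[set x; z.`_p^']>> != G.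
    apply: contraL pG => /eqP <-; rewrite -p'natE // -/(pgroup _ _).
    rewrite set2_gen; have cxz : <[z.`_p^']> \subset 'C(<[x]>).
      by apply: (sub_abelian_cent2 abG); rewrite cycle_subG // groupX.
    rewrite cent_joinEr // pgroupM; apply/andP; split; first exact: p'x.
    exact: p_elt_constt.
  (* Both [x] and [g * x] are vertices, so regularity forces these two cardinals to equal [k]. *)
  suff : #|[set y in G | <<[set x; y]>> == G]| <
         #|[set y in G | <<[set g * x; y]>> == G]|.
    rewrite -!neighbours_Delta // !degG ?ltnn //; apply/Delta_verticesP => //.
      by exists z.`_p^'.
    by exists z.
  apply/proper_card/properP; split.
    apply/subsetP=> y; rewrite !inE => /andP[Gy /eqP gen_xy].
    by rewrite Gy neighbour_gx /=.
  by exists z.`_p^'; rewrite !inE groupX // ?gen_gxz' ?(negPf ngen_xz') /=.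
exists (totient #|G|) => x Vx; have /Delta_verticesP[// | z gen_xz] := Vx.
have Gx : x \in G by rewrite -gen_xz mem_gen ?inE ?eqxx.
rewrite neighbours_Delta // (card_generating_mates abG gen_xz).
have sxG : <[x]> \subset G by rewrite cycle_subG.
(* Multiplying by the index turns [#[x]] into [#|G|], which leaves the cross-multiplied totient
   identity. *)
apply/eqP; rewrite -(eqn_pmul2r (indexg_gt0 G <[x]>)) -mulnA Lagrange //.
by rewrite (eq_primes_totient _ _ (primes_indexg_cycle Gx ncS)).
Qed.
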